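(* There exists an absolute constant $C>0$ such that the following holds. For every constant $q\in(0,1)$ there exist $n_0,\varepsilon_0>0$ such that for every fixed $\varepsilon\in(0,\varepsilon_0)$ and any $n\ge n_0$, setting $p=\frac{1+\varepsilon}{n}$, there is no adaptive algorithm which reveals a path of length $\ell\ge\frac{3C}{\varepsilon}\ln\left(\frac{1}{\varepsilon}\right)$ with probability at least $q$ in $G\sim\mathcal{G}(n,p)$ by querying at most $$\frac{q\,\ell}{8640\,C\,p\,\varepsilon\ln\left(\frac{1}{\varepsilon}\right)}$$ pairs of vertices.
   Context: $\mathcal{G}(n,p)$ is the binomial random graph on vertex set $[n]=\{1,\dots,n\}$: each pair of vertices forms an edge independently with probability $p$. The length of a path is its number of edges. An adaptive algorithm (possibly randomised) interacts with the unknown random graph $G\sim\mathcal{G}(n,p)$ only through successive queries of the form ''is $\{i,j\}\in E(G)$?'' for pairs of vertices $\{i,j\}$; it receives the correct answer to each query, and the choice of each query may depend on the answers to previous queries (and, for a randomised algorithm, on internal randomness independent of $G$). There is no restriction on the amount of computation; only the number of queried pairs is counted. The algorithm reveals a path of length $\ell$ if the graph formed by the queried pairs which were answered positively (i.e. which are edges of $G$) contains a path of length $\ell$. The probability is over the random graph $G$ and the internal randomness of the algorithm. *)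

(* Defs.v *)
From HB Require Import structures.
From mathcomp Require Import all_boot all_order all_algebra.
From mathcomp Require Import all_classical all_reals all_analysis.

Set Implicit Arguments.
Unset Strict Implicit.
Unset Printing Implicit Defensive.

Import Order.TTheory GRing.Theory Num.Theory.

Local Open Scope classical_set_scope.
Local Open Scope ring_scope.

(* Vertices are {0, ..., n-1} rather than {1, ..., n}. *)
Definition vpair (n : nat) : finType := {e : {set 'I_n} | #|e| == 2}.

(* A simple graph on 'I_n is identified with its edge set. *)
Definition graph (n : nat) : finType := {set vpair n}.

Definition adj (n : nat) (G : graph n) : rel 'I_n :=
  fun u v => [exists e in G, val e == finset.setU [set u]%SET [set v]%SET].

(* A path of length l has l edges, hence l + 1 distinct vertices. *)
Definition has_path (n : nat) (G : graph n) (l : nat) : Prop :=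
  exists s : seq 'I_n, [/\ uniq s, size s = l.+1 & sorted (adj G) s].

(* Mass of G under G(n,p), the product of Bernoulli(p) laws over all pairs. *)
Definition gnp {R : realType} (n : nat) (p : R) (G : graph n) : R :=
  \prod_(e : vpair n) (if e \in G then p else 1 - p).

(* A deterministic adaptive algorithm as a decision tree: [Query e t1 t0] asks
   whether e is an edge and continues with t1 on "yes" and with t0 on "no".
   Repeated queries are allowed, but are counted only once below. *)
Inductive strategy (n : nat) : Type :=
  | Stop
  | Query of vpair n & strategy n & strategy n.

Fixpoint queried (n : nat) (t : strategy n) (G : graph n) : {set vpair n} :=
  match t with
  | Stop => finset.set0
  | Query e t1 t0 => (e |: queried (if e \in G then t1 else t0) G)%SET
  end.

Definition revealed (n : nat) (t : strategy n) (G : graph n) : graph n :=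
  (queried t G :&: G)%SET.

(* A randomised algorithm draws a seed from an arbitrary probability space and
   then follows the strategy attached to it; measurability is with respect to
   the discrete sigma-algebra on the countable type of strategies. A
   deterministic algorithm is the case of a constant [run]. *)
Record algorithm (R : realType) (n : nat) := Algorithm {
  seed_display : measure_display;
  seed : measurableType seed_display;
  seed_law : probability seed R;
  run : seed -> strategy n;
  run_measurable : forall B : set (strategy n), measurable (run @^-1` B)
}.

Definition queries_at_most (R : realType) (n : nat) (A : algorithm R n)
    (b : R) : Prop :=
  forall (w : seed A) (G : graph n), (#|queried (run w) G|%:R <= b)%R.

(* Probability under the product of G(n,p) and the law of the seed, i.e. with
   the seed independent of the graph. *)
Definition reveal_prob (R : realType) (n : nat) (A : algorithm R n) (p : R)
    (l : nat) : \bar R :=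
  (\sum_(G : graph n) (gnp p G)%:E
     * seed_law A [set w | has_path (revealed (run w) G) l])%E.

(* Main.v *)
(* Let h be about 1/eps.  Order the edges of a revealed path by the time of their
   first query and split the path at its earliest edge, then split both pieces
   in the same way, and so on.  When e = uv splits a piece into parts of a and b
   edges, both parts consist of edges not yet queried, so that the unqueried part
   of G contains disjoint paths of a edges from u and b edges from v.  By the
   Harris inequality the probability theta_j that a path of j edges leaves a given
   vertex satisfies the recursion of a branching process with mean 1 + eps, hence
   theta_j <= 8 / (j + 1) for j <= h, and by the van den Berg-Kesten inequality
   the two disjoint paths have probability at most theta_a theta_b.  Charge to e
   the number of j <= h such that there are disjoint paths of j and h edges from
   its two ends: a positive query is charged O(eps ln(1/eps)) on average, whereas
   a path of l >= 6 h edges is charged at least l / 6 in total.  The theorem then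
   follows from Markov's inequality. *)

Require Import Defs.
From HB Require Import structures.
From mathcomp Require Import all_boot all_order all_algebra.
From mathcomp Require Import all_classical all_reals all_analysis.
From mathcomp Require Import measurable_realfun zify ring lra.

(* Reimported because mathcomp.classical hides set0, subsetP and others. *)
Import mathcomp.boot.fintype mathcomp.boot.finset.
Import Order.TTheory GRing.Theory Num.Theory.

Local Open Scope ring_scope.


(** * Correlation inequalities for product Bernoulli measures *)

Section BernoulliProduct.
Context {R : realFieldType} {T : finType}.
Variable p : R.
Hypotheses (p_ge0 : 0 <= p) (p_le1 : p <= 1).
Implicit Types (es : seq T) (F H : {set T} -> R).

(* Expectation of F at the random subset of es that keeps each element
   independently with probability p. *)
Fixpoint Ex es F : R :=
  if es is e :: es' then
    p * Ex es' (fun G => F (e |: G)) + (1 - p) * Ex es' F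
  else F set0.

Lemma Ex_sum es F : uniq es ->
  Ex es F = \sum_(G : {set T} | G \subset es)
              (\prod_(e <- es) (if e \in G then p else 1 - p)) * F G.
Proof.
elim: es F => [|e es IH] F /=.
  move=> _; rewrite (big_pred1 set0) ?big_nil ?mul1r // => G.
  by rewrite /= -subset0; apply: eq_subset_r => x; rewrite !inE.
case/andP=> e_es es_uniq; rewrite !IH // !big_distrr /=.
rewrite [RHS](bigID (fun G : {set T} => e \in G)) /=; congr (_ + _).
- rewrite [RHS](reindex_onto (fun G => e |: G) (fun G => G :\ e)) /=; last first.
    by move=> G /andP[_ eG]; rewrite setD1K.
  apply: eq_big => [G|G sG].
    rewrite setU11 andbT; apply/idP/andP => [sG|[sG /eqP <-]].
      split; last by apply/eqP/setU1K; apply: contra e_es => /(subsetP sG).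
      apply/subsetP => x; rewrite !inE => /orP[->//|/(subsetP sG) ->].
      by rewrite orbT.
    apply/subsetP => x; rewrite in_setD1 => /andP[xe xG].
    by have := subsetP sG _ xG; rewrite inE (negbTE xe).
  rewrite big_cons setU11 -!mulrA; congr (_ * (_ * _)).
  rewrite !big_seq; apply: eq_bigr => f fes; rewrite in_setU1.
  by rewrite (_ : f == e = false) //; apply: contraNF e_es => /eqP <-.
- apply: eq_big => [G|G sG].
    apply/idP/andP => [sG|[sG eG]].
      split; last by apply: contra e_es => /(subsetP sG).
      by apply/subsetP => x /(subsetP sG) xes; rewrite inE xes orbT.
    apply/subsetP => x xG; have := subsetP sG _ xG; rewrite inE.
    by case/orP => // /eqP xe; move: xG eG; rewrite xe => ->.
  rewrite big_cons (_ : e \in G = false) ?mulrA //.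
  by apply: contraNF e_es => /(subsetP sG).
Qed.

Lemma eq_Ex es F H : F =1 H -> Ex es F = Ex es H.
Proof.
elim: es F H => [|e es IH] F H eFH //=.
by rewrite (IH F H) // (IH (fun G => F (e |: G)) (fun G => H (e |: G))).
Qed.

Lemma ler_Ex es F H : (forall G, F G <= H G) -> Ex es F <= Ex es H.
Proof.
elim: es F H => [|e es IH] F H le_FH //=.
by rewrite lerD // ler_wpM2l ?subr_ge0 // IH.
Qed.

Lemma ExD es F H : Ex es (fun G => F G + H G) = Ex es F + Ex es H.
Proof. by elim: es F H => [|e es IH] F H //=; rewrite !IH; ring. Qed.

Lemma ExZ es c F : Ex es (fun G => c * F G) = c * Ex es F.
Proof. by elim: es F => [|e es IH] F //=; rewrite !IH; ring. Qed.

Lemma Ex_cst es c : Ex es (fun=> c) = c.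
Proof. by elim: es => [|e es IH] //=; rewrite !IH; ring. Qed.

Lemma Ex_bigsum es I (r : seq I) (F : I -> {set T} -> R) :
  Ex es (fun G => \sum_(i <- r) F i G) = \sum_(i <- r) Ex es (F i).
Proof.
elim: r => [|i r IH].
  by rewrite big_nil (eq_Ex _ _ (fun=> 0)) ?Ex_cst // => G; rewrite big_nil.
by rewrite big_cons -IH -ExD; apply: eq_Ex => G; rewrite big_cons.
Qed.

Lemma Ex_ge0 es F : (forall G, 0 <= F G) -> 0 <= Ex es F.
Proof. by move=> F_ge0; rewrite -(Ex_cst es 0); apply: ler_Ex. Qed.

Lemma Ex_mem es e : uniq es ->
  Ex es (fun G => (e \in G)%:R) = if e \in es then p else 0.
Proof.
elim: es => [|f es IH] /=; first by rewrite inE.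
case/andP=> f_es es_uniq; rewrite inE.
have [ef|ef] /= := eqVneq e f.
  subst f; rewrite IH // (negbTE f_es) (eq_Ex _ _ (fun=> 1)).
    by rewrite Ex_cst; ring.
  by move=> G; rewrite setU11.
rewrite (eq_Ex _ _ (fun G => (e \in G)%:R)).
  by rewrite IH //; case: ifP => _; ring.
by move=> G; rewrite in_setU1 (negbTE ef).
Qed.

(** Independence in coordinate form: no single element influences both functions. At the head of the
    list one of the two takes the same value in both branches and factors out. *)
Lemma Ex_indep es F H :
  (forall e, (forall G, F (e |: G) = F G) \/ (forall G, H (e |: G) = H G)) ->
  Ex es (fun G => F G * H G) = Ex es F * Ex es H.
Proof.
elim: es F H => [|e es IH] F H indep //=.
rewrite (IH F H) // (IH (fun G => F (e |: G)) (fun G => H (e |: G))); last first.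
  by move=> f; case: (indep f) => noF; [left|right] => G; rewrite setUCA noF.
by case: (indep e) => noF; rewrite (eq_Ex es _ _ noF); ring.
Qed.

Definition decreasing F := forall G G' : {set T}, G \subset G' -> F G' <= F G.

(** After conditioning on the head [e], the two sides differ by the induction gain plus
    [p * (1 - p) * (f0 - f1) * (h0 - h1)], whose two differences are nonnegative by monotonicity. *)
Lemma Ex_harris es F H : decreasing F -> decreasing H ->
  Ex es F * Ex es H <= Ex es (fun G => F G * H G).
Proof.
elim: es F H => [|e es IH] F H dF dH //=.
have dU (K : {set T} -> R) : decreasing K -> decreasing (fun G => K (e |: G)).
  by move=> dK G G' sG; apply: dK; apply: setUS.
have leU (K : {set T} -> R) : decreasing K -> Ex es (fun G => K (e |: G)) <= Ex es K.
  by move=> dK; apply: ler_Ex => G; apply: dK; apply: subsetUr.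
have := IH _ _ dF dH; have := IH _ _ (dU _ dF) (dU _ dH) => /=.
have := leU _ dF; have := leU _ dH.
set f1 := Ex es (fun G => F _); set h1 := Ex es (fun G => H _).
set f0 := Ex es F; set h0 := Ex es H => le_h le_f le1 le0.
have le1' := ler_wpM2l p_ge0 le1.
have q_ge0 : 0 <= 1 - p by rewrite subr_ge0.
have le0' := ler_wpM2l q_ge0 le0.
apply: le_trans (lerD le1' le0').
have : 0 <= p * (1 - p) * ((f0 - f1) * (h0 - h1)).
  by rewrite !mulr_ge0 // subr_ge0.
move=> dd_ge0; rewrite -subr_ge0; apply: (le_trans dd_ge0).
by rewrite le_eqVlt; apply/orP; left; apply/eqP; ring.
Qed.

Lemma Ex_harris_prod es I (r : seq I) (F : I -> {set T} -> R) :
  (forall i, decreasing (F i)) -> (forall i G, 0 <= F i G) ->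
  \prod_(i <- r) Ex es (F i) <= Ex es (fun G => \prod_(i <- r) F i G).
Proof.
move=> dF F_ge0; elim: r => [|i r IH].
  rewrite big_nil (eq_Ex _ _ (fun=> 1)) ?Ex_cst // => G.
  by rewrite big_nil.
rewrite big_cons (eq_Ex _ (fun G => \prod_(j <- i :: r) F j G)
  (fun G => F i G * \prod_(j <- r) F j G)); last first.
  by move=> G; rewrite big_cons.
apply: le_trans (Ex_harris _ _ _ _ _) => //.
  by rewrite ler_wpM2l // Ex_ge0.
by move=> G G' sG; apply: ler_prod => j _; rewrite F_ge0 dF.
Qed.

Implicit Types (K : {set T} -> {set T} -> bool) (G I J : {set T}).

Definition increasing2 (K : {set T} -> {set T} -> bool) :=
  forall I I' J J' : {set T}, I \subset I' -> J \subset J' -> K I J -> K I' J'.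

(** Disjoint occurrence, with [K] a relation between two witness sets rather than a pair of events:
    such relations stay in the class when [e] is added to one argument only, as the induction for
    [Ex_boxed] requires. *)
Definition boxed (K : {set T} -> {set T} -> bool) (G : {set T}) : bool :=
  [exists I : {set T}, exists J : {set T},
     [&& [disjoint I & J], I \subset G, J \subset G & K I J]].

Lemma boxedP K G :
  reflect (exists I J, [/\ [disjoint I & J], I \subset G, J \subset G & K I J])
    (boxed K G).
Proof.
apply: (iffP existsP) => [[I /existsP[J /and4P[]]]|[I [J []]]] *.
  by exists I, J.
by exists I; apply/existsP; exists J; apply/and4P.
Qed.

Lemma boxed_sub K K' G : (forall I J, K I J -> K' I J) -> boxed K G -> boxed K' G.
Proof.
move=> sK /boxedP[I [J [dIJ sI sJ KIJ]]]; apply/boxedP; exists I, J.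
by split=> //; apply: sK.
Qed.

Lemma boxedS K G G' : G \subset G' -> boxed K G -> boxed K G'.
Proof.
move=> sG /boxedP[I [J [dIJ sI sJ KIJ]]]; apply/boxedP; exists I, J.
by split=> //; apply: subset_trans sG.
Qed.

(* Van den Berg-Kesten: an edge e is replaced by two independent copies, one
   available to I and one to J, one edge at a time. *)
Lemma Ex_boxed es K : increasing2 K ->
  Ex es (fun G => (boxed K G)%:R)
    <= Ex es (fun G1 => Ex es (fun G2 => (K G1 G2)%:R)).
Proof.
elim: es K => [|e es IH] K incK /=.
  rewrite ler_nat; case: boxedP => // -[I [J [_ sI sJ KIJ]]].
  by rewrite (incK _ _ _ _ sI sJ KIJ).
pose Kl I J := K (e |: I) J; pose Kr I J := K I (e |: J).
pose Klr I J := K (e |: I) (e |: J).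
have incl : increasing2 Kl by move=> I I' J J' sI sJ; apply: incK => //; apply: setUS.
have incr : increasing2 Kr by move=> I I' J J' sI sJ; apply: incK => //; apply: setUS.
have inclr : increasing2 Klr by move=> I I' J J' sI sJ; apply: incK; apply: setUS.
have split2 (K1 K2 : {set T} -> {set T} -> bool) :
    Ex es (fun G1 => p * Ex es (fun G2 => (K1 G1 G2)%:R)
                     + (1 - p) * Ex es (fun G2 => (K2 G1 G2)%:R))
    = p * Ex es (fun G1 => Ex es (fun G2 => (K1 G1 G2)%:R))
      + (1 - p) * Ex es (fun G1 => Ex es (fun G2 => (K2 G1 G2)%:R)).
  by rewrite -!ExZ -ExD.
rewrite (split2 Klr Kl) (split2 Kr K).
have q_ge0 : 0 <= 1 - p by rewrite subr_ge0.
have IH00 := ler_wpM2l (mulr_ge0 q_ge0 q_ge0) (IH _ incK).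
have IH10 := ler_wpM2l (mulr_ge0 p_ge0 q_ge0) (IH _ incl).
have IH01 := ler_wpM2l (mulr_ge0 p_ge0 q_ge0) (IH _ incr).
have IH11 := ler_wpM2l (mulr_ge0 p_ge0 p_ge0) (IH _ inclr).
have IHs := lerD (lerD IH00 IH10) (lerD IH01 IH11).
apply: le_trans (le_trans IHs _); last by rewrite /Kl /Kr /Klr; lra.
rewrite -!ExZ -!ExD; apply: ler_Ex => G.
have sub_l : boxed K G -> boxed Kl G.
  by apply: boxed_sub => I J; apply: incK => //; apply: subsetUr.
have sub_r : boxed K G -> boxed Kr G.
  by apply: boxed_sub => I J; apply: incK => //; apply: subsetUr.
have sub_lr : boxed Kl G -> boxed Klr G.
  by apply: boxed_sub => I J; apply: incK => //; apply: subsetUr.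
have sub_rr : boxed Kr G -> boxed Klr G.
  by apply: boxed_sub => I J; apply: incK => //; apply: subsetUr.
(* Disjoint witnesses cannot both use [e], so it can be handed to one side alone. *)
have : boxed K (e |: G) -> boxed Kl G || boxed Kr G.
  case/boxedP=> I [J [dIJ sI sJ KIJ]].
  have sD (A : {set T}) : A \subset e |: G -> A :\ e \subset G.
    by rewrite subDset.
  have dD : [disjoint I :\ e & J :\ e].
    by apply: disjointWl (subsetDl _ _) _; apply: disjointWr (subsetDl _ _) _.
  have UD (A : {set T}) : A \subset e |: (A :\ e) by rewrite -subDset.
  have [eI|eI] := boolP (e \in I); apply/orP; [left|right]; apply/boxedP;
    exists (I :\ e), (J :\ e); split; rewrite ?sD //.
    apply: incK KIJ; first exact: UD.
    apply/subsetP => x xJ; rewrite in_setD1 xJ andbT.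
    by apply: contraTneq xJ => ->; rewrite (disjointFr dIJ eI).
  apply: incK KIJ; last exact: UD.
  apply/subsetP => x xI; rewrite in_setD1 xI andbT.
  by apply: contraNneq eI => <-.
have pq_ge0 := mulr_ge0 p_ge0 q_ge0.
have pp_ge0 := mulr_ge0 p_ge0 p_ge0.
clearbody Kl Kr Klr.
move: sub_l sub_r sub_lr sub_rr.
(* A check over truth values: each assignment satisfies the inequality in [p] or violates one of the
   five implications. *)
move: (boxed K G) (boxed Kl G) (boxed Kr G) (boxed Klr G) (boxed K (e |: G)).
case; case; case; case; case => /= b0l b0r blr brr b1; rewrite ?mulr1 ?mulr0; try nra.
all: first [by have := b1 isT | by have := blr isT | by have := brr isT
           | by have := b0l isT | by have := b0r isT].
Qed.

End BernoulliProduct.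


(** * Survival probabilities *)

Section Survival.
Context {n : nat}.
Implicit Types (G H A : graph n) (S : {set 'I_n}) (u v w : 'I_n) (e f : vpair n).

Lemma adjP G u v :
  reflect (exists2 e, e \in G & val e = [set u; v]) (adj G u v).
Proof.
apply: (iffP existsP) => [[e /andP[eG /eqP ve]]|[e eG ve]]; exists e => //.
by rewrite eG ve eqxx.
Qed.

Lemma vpair_neq e u v : val e = [set u; v] -> u != v.
Proof.
move=> ve; have := valP e; rewrite /= ve cards2.
by case: (u != v).
Qed.

Lemma adj_sym G u v : adj G u v = adj G v u.
Proof. by rewrite /adj setUC. Qed.

Lemma adj_sub G H u v : G \subset H -> adj G u v -> adj H u v.
Proof. by move=> sGH /adjP[e /(subsetP sGH) eH ve]; apply/adjP; exists e. Qed.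

(* G has a path of j edges starting at v whose other vertices avoid S. *)
Fixpoint extends (j : nat) S v G : bool :=
  if j is j'.+1 then
    [exists w, [&& w \notin v |: S, adj G v w & extends j' (v |: S) w G]]
  else true.

Lemma extends_sub j S v G H : G \subset H -> extends j S v G -> extends j S v H.
Proof.
elim: j S v => [|j IH] S v sGH //= /existsP[w /and3P[wS vw ext]].
by apply/existsP; exists w; rewrite wS (adj_sub _ _ _ _ sGH vw) IH.
Qed.

Lemma adjU1 G e u v : val e != [set u; v] -> adj (e |: G) u v = adj G u v.
Proof.
move=> ve; apply/adjP/adjP => -[f fG vf]; exists f => //.
  by move: fG; rewrite in_setU1 => /orP[/eqP fe|//]; rewrite -fe vf eqxx in ve.
by rewrite in_setU1 fG orbT.
Qed.

(** A path that starts outside [S] and avoids [S] never meets [x], hence never uses [e]. This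
    separates a first edge [vw] from the continuation out of [w], which avoids [v]. *)
Lemma extendsU1 j S v G e x : x \in S -> x \in val e -> v \notin S ->
  extends j S v (e |: G) = extends j S v G.
Proof.
elim: j S v => [|j IH] S v xS xe vS //=; apply: eq_existsb => w.
have [//|wS] /= := boolP (w \in v |: S).
rewrite IH //; last by rewrite in_setU1 xS orbT.
rewrite adjU1 //.
apply: contraNneq wS => ve; move: xe; rewrite ve !inE.
by case/orP=> /eqP xv; [rewrite xv (negbTE vS) in xS|rewrite -xv xS orbT].
Qed.

Lemma path_extends j S v (s : seq 'I_n) G : (j <= size s)%N ->
  uniq (v :: s) -> {in v :: s, forall x, x \notin S} -> path (adj G) v s ->
  extends j S v G.
Proof.
elim: j S v s => [|j IH] S v [|w s] //= js /andP[vs us] sS /andP[vw ws].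
apply/existsP; exists w; rewrite vw /=; apply/andP; split.
  rewrite in_setU1 negb_or sS ?inE ?eqxx ?orbT // andbT.
  by apply: contraNneq vs => <-; rewrite inE eqxx.
apply: (IH _ _ s) => // x xs; rewrite in_setU1 negb_or; apply/andP; split.
  by apply: contraNneq vs => <-.
by apply: sS; rewrite inE xs orbT.
Qed.

End Survival.

(* The survival probability to generation j of a branching process
   with offspring law Bin(n, p). *)
Fixpoint theta {R : realFieldType} (n : nat) (p : R) (j : nat) : R :=
  if j is j'.+1 then 1 - (1 - p * theta n p j') ^+ n else 1.

Section SurvivalProbability.
Context {R : realFieldType} {n : nat}.
Variable p : R.
Hypotheses (p_ge0 : 0 <= p) (p_le1 : p <= 1).
Local Notation E := (Ex p (enum (vpair n))).

Local Notation theta := (theta n p).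

Lemma theta_itv j : 0 <= theta j <= 1.
Proof.
elim: j => [|j /andP[IH0 IH1]] /=; first by rewrite ler01 lexx.
have pt0 : 0 <= p * theta j by rewrite mulr_ge0.
have pt1 : p * theta j <= 1 by rewrite mulr_ile1.
by rewrite subr_ge0 gerBl exprn_ile1 ?exprn_ge0 ?subr_ge0 // gerBl.
Qed.

Lemma Ex_adj_le v w : E (fun G => (adj G v w)%:R) <= p.
Proof.
case: (pickP (fun e : vpair n => val e == [set v; w])) => [e /eqP ve|none].
  rewrite (eq_Ex _ _ _ (fun G => (e \in G)%:R)).
    by rewrite Ex_mem ?enum_uniq // mem_enum.
  move=> G; congr (nat_of_bool _)%:R; apply/adjP/idP => [[f fG vf]|eG].
    by have -> : e = f by apply/val_inj; rewrite ve vf.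
  by exists e.
rewrite (eq_Ex _ _ _ (fun=> 0)) ?Ex_cst // => G.
by case: adjP => // -[e _ /eqP]; rewrite none.
Qed.

(** Failure means that every [w] misses. Misses are decreasing, so Harris bounds the failure
    probability below by a product over [w]; each factor is at least [1 - p * theta j], since the
    edge [vw] is independent of the continuation from [w]. *)
Lemma Ex_extends_le j S v : E (fun G => (extends j S v G)%:R) <= theta j.
Proof.
elim: j S v => [|j IH] S v; first by rewrite /= Ex_cst.
pose miss w G : R :=
  1 - ([&& w \notin v |: S, adj G v w & extends j (v |: S) w G])%:R.
have -> : E (fun G => (extends j.+1 S v G)%:R)
    = 1 - E (fun G => \prod_(w <- enum 'I_n) miss w G).
  have : E (fun G => (extends j.+1 S v G)%:R + \prod_(w <- enum 'I_n) miss w G) = 1.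
    rewrite (eq_Ex _ _ _ (fun=> 1)) ?Ex_cst // => G /=.
    rewrite big_enum; case: existsP => [[w Hw]|none].
      by rewrite (bigD1 w) //= /miss Hw subrr mul0r addr0.
    rewrite big1 ?add0r // => w _; rewrite /miss.
    by case: andP => [Hw|_]; [case: none; exists w; apply/andP|rewrite subr0].
  by rewrite ExD => sum1; rewrite -[X in _ = X - _]sum1 addrK.
rewrite lerD2l lerN2 -[X in _ ^+ X](card_ord n) -prodr_const -big_enum -/(theta j) /=.
apply: le_trans (Ex_harris_prod p p_ge0 p_le1 _ _ _ _ _ _); last 2 first.
- move=> w G H sGH; rewrite /miss lerD2l lerN2 ler_nat.
  case: and3P => // -[wS vw ext].
  by rewrite wS (adj_sub _ _ _ _ sGH vw) (extends_sub _ _ _ _ _ sGH ext).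
- by move=> w G; rewrite /miss subr_ge0 lern1 leq_b1.
have /andP[t_ge0 t_le1] := theta_itv j.
apply: ler_prod => w _; rewrite -/(theta j).
rewrite subr_ge0 mulr_ile1 //=.
rewrite /miss ExD Ex_cst lerD2l.
rewrite (eq_Ex _ _ _ (fun G => (-1) *
  ([&& w \notin v |: S, adj G v w & extends j (v |: S) w G])%:R)); last first.
  by move=> G; rewrite mulN1r.
rewrite ExZ mulN1r lerN2.
have [wS|wS] /= := boolP (w \in v |: S).
  by rewrite Ex_cst mulr_ge0.
rewrite (eq_Ex _ _ _ (fun G => (adj G v w)%:R * (extends j (v |: S) w G)%:R)); last first.
  by move=> G; rewrite -natrM mulnb.
rewrite Ex_indep.
  apply: ler_pM; rewrite ?Ex_ge0 //.
  exact: Ex_adj_le.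
move=> e; have [ve|ve] := eqVneq (val e) [set v; w].
  right=> G; congr (nat_of_bool _)%:R.
  by apply: (extendsU1 _ _ _ _ _ v) => //; rewrite ?ve !inE eqxx.
by left=> G; rewrite adjU1.
Qed.

(* For e = uv, G has edge-disjoint paths of j edges from u and h edges from v. *)
Definition cross (j h : nat) (e : vpair n) (G : graph n) : bool :=
  [exists u, exists v, (val e == [set u; v])
     && boxed (fun I J => extends j set0 u I && extends h set0 v J) G].

Lemma crossS j h e (G H : graph n) : G \subset H -> cross j h e G -> cross j h e H.
Proof.
move=> sGH /existsP[u /existsP[v /andP[ve box]]].
by apply/existsP; exists u; apply/existsP; exists v; rewrite ve (boxedS _ _ _ sGH box).
Qed.

Lemma Ex_boxed_extends_le j h u v :
  E (fun G => (boxed (fun I J => extends j set0 u I && extends h set0 v J) G)%:R)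
    <= theta j * theta h.
Proof.
apply: le_trans (Ex_boxed _ p_ge0 p_le1 _ _ _) _.
  move=> I I' J J' sI sJ /andP[extI extJ].
  by rewrite (extends_sub _ _ _ _ _ sI extI) (extends_sub _ _ _ _ _ sJ extJ).
rewrite (eq_Ex _ _ _ (fun G1 =>
  E (fun G2 => (extends h set0 v G2)%:R) * (extends j set0 u G1)%:R)).
  by rewrite ExZ mulrC ler_pM ?Ex_ge0 ?Ex_extends_le.
move=> G1; rewrite mulrC -ExZ; apply: eq_Ex => G2.
by rewrite -natrM mulnb.
Qed.

Lemma Ex_cross_le j h e :
  E (fun G => (cross j h e G)%:R) <= 2 * (theta j * theta h).
Proof.
have /cards2P[a [b [ab ve]]] := valP e.
(* The two terms are the two orientations of [e], whence the factor 2. *)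
apply: (@le_trans _ _ (E (fun G =>
    (boxed (fun I J => extends j set0 a I && extends h set0 b J) G)%:R
  + (boxed (fun I J => extends j set0 b I && extends h set0 a J) G)%:R))).
  apply: ler_Ex => // G; case: (boolP (cross _ _ _ _)) => [|_]; last by rewrite addr_ge0.
  case/existsP=> u /existsP[v /andP[/eqP vuv box]].
  have uv := vpair_neq _ _ _ vuv.
  have : u \in [set a; b] by rewrite -ve vuv !inE eqxx.
  have : v \in [set a; b] by rewrite -ve vuv !inE eqxx orbT.
  rewrite !inE => /orP[] /eqP Ev /orP[] /eqP Eu; subst u v; rewrite ?eqxx // in uv.
    by rewrite box lerDr.
  by rewrite box lerDl.
by rewrite ExD mulr2n mulrDl !mul1r lerD // Ex_boxed_extends_le.
Qed.

End SurvivalProbability.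


(** * Charging the edges of a revealed path *)

Section Score.
Context {n : nat}.
Variable h : nat.
Implicit Types (G H A Q : graph n) (u v w x y : 'I_n) (e f : vpair n) (t : strategy n).

(* The charge to e when G is the unqueried part of the random graph. *)
Definition score e G : nat := (\sum_(j < h.+1) cross j h e G)%N.

(* The queries preceding the first query of e, together with the set Q of the
   pairs queried before t starts. *)
Fixpoint prior t Q G e : {set vpair n} :=
  if t is Query f t1 t0 then
    if e == f then Q else prior (if f \in G then t1 else t0) (f |: Q) G e
  else Q.

(** The charges collected along the run, at first queries of edges only. The recursion on the tree
    is the form suited to taking expectations. *)
Fixpoint cost t Q G : nat :=
  if t is Query e t1 t0 then
    ((if e \in Q then 0 else (e \in G) * score e (G :\: (e |: Q)))
     + cost (if e \in G then t1 else t0) (e |: Q) G)%N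
  else 0%N.

Lemma sum_prior_cost t Q G :
  (\sum_(e in (queried t G :\: Q) :&: G) score e (G :\: (e |: prior t Q G e))
    = cost t Q G)%N.
Proof.
elim: t Q => [|e t1 IH1 t0 IH0] Q /=.
  by rewrite big1 // => f; rewrite !inE andbF.
set t' := if e \in G then t1 else t0.
have IH : (\sum_(f in (queried t' G :\: (e |: Q)) :&: G)
    score f (G :\: (f |: prior t' (e |: Q) G f)) = cost t' (e |: Q) G)%N.
  by rewrite /t'; case: (e \in G).
rewrite -{}IH.
case: (boolP ((e \notin Q) && (e \in G))) => [/andP[eQ eG]|eQG].
  rewrite (negbTE eQ) eG mul1n (bigD1 e) /=; last by rewrite !inE eqxx eQ eG.
  rewrite eqxx; congr (_ + _)%N; apply: eq_big => [f|f].
    by rewrite !inE; case: eqP => //=; rewrite ?andbF //= andbT.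
  by case/andP=> _ /negbTE ->.
rewrite (_ : (if e \in Q then _ else _) = 0%N) ?add0n; last first.
  by move: eQG; case: (e \in Q) => //= /negbTE ->.
apply: eq_big => [f|f].
  rewrite !inE; case: eqP => [->|] //=; move: eQG.
  by case: (e \in Q); case: (e \in G); rewrite ?andbF.
rewrite !inE; case: eqP => // -> /andP[/andP[eQ _] eG].
by rewrite eQ eG in eQG.
Qed.

(** The witness is the element of [A] that is queried first. *)
Lemma prior_min t Q G A : A != set0 -> A \subset queried t G :\: Q ->
  exists2 e, e \in A & [disjoint prior t Q G e & A].
Proof.
elim: t Q => [|f t1 IH1 t0 IH0] Q A0 /=.
  by rewrite set0D subset0 (negbTE A0).
set t' := if f \in G then t1 else t0 => sA.
have [fA|fA] := boolP (f \in A).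
  exists f => //; rewrite eqxx disjoint_sym.
  by move: sA; rewrite subsetD => /andP[].
have sA' : A \subset queried t' G :\: (f |: Q).
  apply/subsetP => x xA; have := subsetP sA _ xA; rewrite !inE.
  by have [xf|//] := eqVneq x f; rewrite -xf xA in fA.
have [e eA dA] : exists2 e, e \in A & [disjoint prior t' (f |: Q) G e & A].
  by move: sA'; rewrite /t'; case: (f \in G); [apply: IH1|apply: IH0].
by exists e => //; case: eqP => // ef; rewrite -ef eA in fA.
Qed.

(** Restricting pairs to a vertex set makes the edge sets of two vertex-disjoint halves of a path
    disjoint. *)
Definition induced (s : seq 'I_n) A : graph n :=
  [set f in A | val f \subset s].

Lemma sorted_induced s A : sorted (adj A) s -> sorted (adj (induced s A)) s.
Proof.
apply: (sub_in_sorted (P := mem s)); last exact/allP.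
move=> x y xs ys /adjP[e eA ve]; apply/adjP; exists e => //.
by rewrite inE eA ve /=; apply/subsetP => z; rewrite !inE => /orP[]/eqP->.
Qed.

Lemma extends_induced j x s A G : (j <= size s)%N -> uniq (x :: s) ->
  path (adj A) x s -> induced (x :: s) A \subset G -> extends j set0 x G.
Proof.
move=> js us ps sG; apply: extends_sub sG _; apply: (path_extends _ _ _ s) => //.
  by move=> z _; rewrite inE.
exact: (sorted_induced (x :: s)).
Qed.

Lemma score_ge a e G : (forall j, (j <= a)%N -> (j <= h)%N -> cross j h e G) ->
  (minn a h < score e G)%N.
Proof.
move=> Hcross; rewrite /score.
have count_le m : (\sum_(j < m) (j <= a) = minn a.+1 m)%N.
  by elim: m => [|m IH]; rewrite ?big_ord0 ?big_ord_recr /= ?IH; lia.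
apply: (@leq_trans (\sum_(j < h.+1) (j <= a))%N); first by rewrite count_le; lia.
apply: leq_sum => j _; case: (leqP j a) => // ja.
by rewrite Hcross // -ltnS.
Qed.

Lemma path_split (T : Type) (r r' : rel T) (s : seq T) :
  sorted r s -> ~~ sorted r' s ->
  exists s1 (x y : T) s2, [/\ s = rcons s1 x ++ y :: s2, r x y & ~~ r' x y].
Proof.
case: s => [|x s] //=; elim: s x => [|y s IH] x //= /andP[rxy rs].
rewrite negb_and => /orP[nr|nr]; first by exists [::], x, y, s.
have [s1 [x' [y' [s2 [eqs r1 r2]]]]] := IH _ rs nr.
by exists (x :: s1), x', y', s2; split; rewrite // eqs.
Qed.

Lemma disjoint_induced (a b : seq 'I_n) A :
  uniq (a ++ b) -> [disjoint induced a A & induced b A].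
Proof.
rewrite cat_uniq => /and3P[_ dab _].
rewrite -setI_eq0; apply/eqP/setP => f; rewrite !inE; apply/negP.
case/andP=> /andP[_ /subsetP fa] /andP[_ /subsetP fb].
have /cards2P[u [v [_ vf]]] := valP f.
have uf : u \in val f by rewrite /= vf !inE eqxx.
by move: dab => /hasPn/(_ _ (fb _ uf)); rewrite (fa _ uf).
Qed.

Lemma cross_split j (a b : seq 'I_n) x y e A G : val e = [set x; y] ->
  (j <= size a)%N -> (h <= size b)%N -> uniq ((x :: a) ++ (y :: b)) ->
  path (adj A) x a -> path (adj A) y b ->
  induced (x :: a) A \subset G -> induced (y :: b) A \subset G ->
  cross j h e G.
Proof.
move=> ve ja hb; rewrite cat_uniq => /and3P[ua dab ub] pa pb sa sb.
apply/existsP; exists x; apply/existsP; exists y; rewrite ve eqxx /=.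
apply/boxedP; exists (induced (x :: a) A), (induced (y :: b) A); split=> //.
  by apply: disjoint_induced; rewrite cat_uniq ua dab ub.
by rewrite (extends_induced _ _ _ _ _ ja ua pa) ?(extends_induced _ _ _ _ _ hb ub pb).
Qed.

(** [P] abstracts [prior]. Induction on [#|A|], removing a pair [e] for which [P e] misses [A]. If
    the path does without [e], the bound is inherited; otherwise the halves live in disjoint sets
    [A1] and [A2], each bound has a slack [3 * h], and the charge to [e] pays for the extra one. *)
Lemma path_le_score (P : vpair n -> {set vpair n}) G H A (s : seq 'I_n) :
    (0 < h)%N -> H \subset G ->
    (forall A, A != set0 -> A \subset H ->
       exists2 e, e \in A & [disjoint P e & A]) ->
    A \subset H -> uniq s -> sorted (adj A) s ->
  (size s <= 3 * \sum_(e in A) score e (G :\: (e |: P e)) + 3 * h)%N.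
Proof.
move=> h_gt0 sHG Pmin.
pose Y f := score f (G :\: (f |: P f)).
pose W (B : graph n) := (\sum_(f in B) Y f)%N.
rewrite -/(W A).
have [m] := ubnP #|A|; elim: m A s => // m IH A s Am sA us ps.
have [|s_large] := leqP (size s) (3 * h); first by lia.
have [A0|A0] := eqVneq A set0.
  case: s us ps s_large => [|x [|y s]] /=; [by []|by move=> _ _ /=; lia|move=> _].
  by case/andP=> /adjP[e]; rewrite A0 inE.
have [e eA dPA] := Pmin A A0 sA.
have cardD : (#|A :\ e| < m)%N.
  by move: Am; rewrite (cardsD1 e) eA; lia.
have WA : W A = (Y e + W (A :\ e))%N by rewrite /W (big_setD1 e).
have [ps'|nps] := boolP (sorted (adj (A :\ e)) s).
  by have := IH (A :\ e) s cardD (subset_trans (subsetDl _ _) sA) us ps'; lia.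
have [s1 [x [y [s2 [eqs xy nxy]]]]] := path_split _ _ _ _ ps nps.
have ve : val e = [set x; y].
  move/adjP: xy => [f fA vf]; have [<- //|fe] := eqVneq f e.
  by case/adjP: nxy; exists f => //; rewrite !inE fe.
move: us ps s_large; rewrite eqs => us ps s_large.
(* Reversed, so that both halves start at an end of [e]. *)
pose a := rev s1.
have a_perm : perm_eq (x :: a) (rcons s1 x).
  by rewrite perm_sym perm_rcons perm_cons perm_sym perm_rev.
have ua : uniq ((x :: a) ++ (y :: s2)).
  by rewrite (perm_uniq (s2 := rcons s1 x ++ y :: s2)) // perm_cat2r.
have ub : uniq ((y :: s2) ++ (x :: a)) by rewrite uniq_catC.
have [ps1 pb] := cat_sorted2 ps.
have pa : path (adj A) x a.
  suff : sorted (adj A) (x :: a) by [].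
  rewrite -rev_rcons rev_sorted (eq_sorted (e' := adj A)) // => u v.
  by rewrite adj_sym.
pose A1 := induced (x :: a) A; pose A2 := induced (y :: s2) A.
have A12 : [disjoint A1 & A2] by apply: disjoint_induced.
have sA1 : A1 \subset A by apply/subsetP => f; rewrite inE => /andP[].
have sA2 : A2 \subset A by apply/subsetP => f; rewrite inE => /andP[].
have eA1 : e \notin A1.
  rewrite inE eA /= ve; apply/subsetP => /(_ y); rewrite !inE eqxx orbT => /(_ isT) ya.
  by move: ua; rewrite cat_uniq => /and3P[_ /hasPn/(_ y)]; rewrite !inE eqxx ya => /(_ isT).
have eA2 : e \notin A2.
  rewrite inE eA /= ve; apply/subsetP => /(_ x); rewrite !inE eqxx => /(_ isT) xb.
  by move: ub; rewrite cat_uniq => /and3P[_ /hasPn/(_ x)]; rewrite !inE eqxx xb => /(_ isT).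
have sD (B : graph n) : B \subset A -> e \notin B -> B \subset A :\ e.
  by move=> sB eB; rewrite subsetD1 sB.
(* As [P e] misses [A], both halves are still unqueried when [e] is charged. *)
have sG (B : graph n) : B \subset A -> e \notin B -> B \subset G :\: (e |: P e).
  move=> sB eB; apply/subsetP => f fB; have fA := subsetP sB _ fB.
  rewrite !inE (subsetP (subset_trans sA sHG) _ fA) (disjointFl dPA fA) orbF andbT.
  by apply: contraNneq eB => <-.
have a_mem : x :: a =i rcons s1 x by apply: perm_mem.
have us1 : uniq (rcons s1 x) by move: us; rewrite cat_uniq => /and3P[].
have us2 : uniq (y :: s2) by move: us; rewrite cat_uniq => /and3P[].
have p1 : sorted (adj A1) (rcons s1 x).
  have -> : A1 = induced (rcons s1 x) A.
    by apply/setP => f; rewrite !inE (eq_subset_r a_mem).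
  exact: sorted_induced.
have IH1 := IH A1 _ (leq_ltn_trans (subset_leq_card (sD _ sA1 eA1)) cardD)
  (subset_trans sA1 sA) us1 p1.
have IH2 := IH A2 _ (leq_ltn_trans (subset_leq_card (sD _ sA2 eA2)) cardD)
  (subset_trans sA2 sA) us2 (sorted_induced _ _ pb).
have sumD : (W A1 + W A2 <= W (A :\ e))%N.
  rewrite /W [leqRHS](big_setID A1) /= (setIidPr (sD _ sA1 eA1)) leq_add2l.
  rewrite big_mkcond [leqRHS]big_mkcond; apply: leq_sum => f _.
  case: ifP => // fA2; rewrite ifT // inE (subsetP (sD _ sA2 eA2)) // andbT.
  by rewrite (disjointFl A12 fA2).
have size_s : size (rcons s1 x ++ y :: s2) = ((size a).+1 + (size s2).+1)%N.
  by rewrite size_cat size_rcons size_rev.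
rewrite size_s in s_large *; rewrite size_rcons -(size_rev s1) -/a /= in IH1 IH2.
have Ye_b : (h <= size s2)%N -> (minn (size a) h < Y e)%N.
  move=> hb; apply: score_ge => j ja _.
  by apply: (cross_split j a s2 x y e A) => //; apply: sG.
have Ye_a : (h <= size a)%N -> (minn (size s2) h < Y e)%N.
  move=> ha; apply: score_ge => j jb _.
  by apply: (cross_split j s2 a y x e A) => //; rewrite ?sG // setUC.
(* If both halves have at least [h] edges, [e] is charged more than [h], which covers one slack. If
   one is shorter, the other has at least [h] edges by [s_large], and the charge to [e] covers all
   vertices of the short half. *)
move: h_gt0 s_large WA sumD IH1 IH2 Ye_a Ye_b.
move: (W A) (W (A :\ e)) (W A1) (W A2) (Y e) (size a) (size s2) => wA wD w1 w2 ye na nb.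
by clear; lia.
Qed.

End Score.


(** * Expected charge *)

Section ExpectedCost.
Context {R : realFieldType} {n : nat}.
Variables (p : R) (h : nat).
Hypotheses (p_ge0 : 0 <= p) (p_le1 : p <= 1).
Local Notation E := (Ex p (enum (vpair n))).
Local Notation theta := (theta n p).

Definition score_bound : R := \sum_(j < h.+1) 2 * (theta j * theta h).

Lemma scoreS e (G H : graph n) : G \subset H -> (score h e G <= score h e H)%N.
Proof.
move=> sGH; apply: leq_sum => j _.
by case: (boolP (cross j h e G)) => // /(crossS _ _ _ _ _ sGH) ->.
Qed.

Lemma Ex_score_le e : E (fun G => (score h e G)%:R) <= score_bound.
Proof.
rewrite (eq_Ex _ _ _ (fun G => \sum_(j <- enum 'I_h.+1) (cross j h e G)%:R)); last first.
  by move=> G; rewrite /score natr_sum big_enum.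
rewrite Ex_bigsum /score_bound -big_enum; apply: ler_sum => j _.
exact: Ex_cross_le.
Qed.

(** [F] acts as the indicator that the run reaches this node after querying [Q], so it depends on
    the pairs of [Q] only. At a new query [e], this event, the status of [e] and the score on the
    remaining pairs are independent: each query costs at most [p * score_bound] on average. *)
Lemma Ex_cost_le (t : strategy n) (Q : graph n) (F : graph n -> R) :
  (forall G, 0 <= F G) -> (forall e G, e \notin Q -> F (e |: G) = F G) ->
  E (fun G => F G * (cost h t Q G)%:R)
    <= p * score_bound * E (fun G => F G * #|queried t G :\: Q|%:R).
Proof.
elim: t Q F => [|e t1 IH1 t0 IH0] Q F F_ge0 F_Q.
  rewrite (eq_Ex _ _ _ (fun=> 0)) => [|G]; last by rewrite mulr0.
  rewrite (eq_Ex _ _ (fun G => F G * _) (fun=> 0)) => [|G]; last first.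
    by rewrite /= set0D cards0 mulr0.
  by rewrite Ex_cst mulr0.
pose F1 G := F G * (e \in G)%:R; pose F0 G := F G * (e \notin G)%:R.
have F1_ge0 G : 0 <= F1 G by rewrite mulr_ge0.
have F0_ge0 G : 0 <= F0 G by rewrite mulr_ge0.
have F1_Q f G : f \notin e |: Q -> F1 (f |: G) = F1 G.
  rewrite !in_setU1 negb_or => /andP[fe fQ].
  by rewrite /F1 F_Q // in_setU1 eq_sym (negbTE fe).
have F0_Q f G : f \notin e |: Q -> F0 (f |: G) = F0 G.
  rewrite !in_setU1 negb_or => /andP[fe fQ].
  by rewrite /F0 F_Q // in_setU1 eq_sym (negbTE fe).
have B_ge0 : 0 <= score_bound.
  by apply: le_trans (Ex_score_le e); apply: Ex_ge0.
rewrite (eq_Ex _ _ _ (fun G =>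
  F1 G * (if e \in Q then 0 else (score h e (G :\: (e |: Q)))%:R) +
  (F1 G * (cost h t1 (e |: Q) G)%:R + F0 G * (cost h t0 (e |: Q) G)%:R))); last first.
  move=> G; rewrite /F1 /F0 /=; case: (e \in Q); case: (e \in G) => /=;
  by rewrite ?natrD ?mul1n ?mul0n ?add0n; ring.
rewrite [leRHS](_ : _ = p * score_bound * (E (fun G => F G * (e \notin Q)%:R) +
  (E (fun G => F1 G * #|queried t1 G :\: (e |: Q)|%:R) +
   E (fun G => F0 G * #|queried t0 G :\: (e |: Q)|%:R)))); last first.
  congr (_ * _); rewrite -!ExD; apply: eq_Ex => G /=.
  set t' := if e \in G then t1 else t0.
  have -> : #|(e |: queried t' G) :\: Q| =
      ((e \notin Q) + #|queried t' G :\: (e |: Q)|)%N.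
    rewrite (cardsD1 e) !inE eqxx andbT; congr (_ + _)%N.
    by apply: eq_card => f; rewrite !inE; case: (f == e); rewrite ?andbF.
  rewrite natrD /F1 /F0 /t'; case: (e \in G) => /=; ring.
rewrite !ExD !mulrDr; apply: lerD; last by apply: lerD; [apply: IH1|apply: IH0].
have [eQ|eQ] := boolP (e \in Q).
  rewrite (eq_Ex _ _ _ (fun=> 0)) => [|G]; last by rewrite mulr0.
  by rewrite Ex_cst !mulr_ge0 // Ex_ge0 // => G; rewrite mulr_ge0.
(* [F1] sees only the pairs of [e |: Q], the score only the others. *)
rewrite Ex_indep; last first.
  move=> f; have [fQ|fQ] := boolP (f \in e |: Q); [right|left] => G; last exact: F1_Q.
  congr (score h e _)%:R; apply/setP => x; rewrite !inE.
  by case: (eqVneq x f) => // ->; move: fQ; rewrite in_setU1 => ->.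
rewrite /F1 (Ex_indep p _ F (fun G => (e \in G)%:R)); last first.
  move=> f; have [->|fe] := eqVneq f e; [left|right] => G; first exact: F_Q.
  by rewrite in_setU1 eq_sym (negbTE fe).
rewrite Ex_mem ?enum_uniq // mem_enum inE.
rewrite (eq_Ex _ _ (fun G => F G * _) F) => [|G]; last by rewrite mulr1.
have EF_ge0 : 0 <= E F by apply: Ex_ge0.
have Es : E (fun G => (score h e (G :\: (e |: Q)))%:R) <= score_bound.
  apply: le_trans (Ex_score_le e); apply: ler_Ex => // G.
  by rewrite ler_nat scoreS // subsetDl.
have -> : p * score_bound * E F = E F * p * score_bound by ring.
by rewrite ler_wpM2l ?mulr_ge0.
Qed.

(** For [x > 0] and [X] binomial with [m.+1] trials, this says that the mean of [X] given [X > 0] is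
    at least [1 + m x / 2]. The gain over the union bound is what makes [theta] decay. *)
Lemma one_sub_expr_le (x : R) m : 0 <= x <= 1 ->
  (1 - (1 - x) ^+ m.+1) * (1 + m%:R * x / 2) <= m.+1%:R * x.
Proof.
move=> /andP[x0 x1]; elim: m => [|m IH]; first by rewrite expr1; lra.
have m_ge0 : 0 <= m%:R :> R by [].
have A_gt0 : 0 < 1 + m%:R * x / 2 by nra.
rewrite -(ler_pM2r A_gt0).
have -> : 1 - (1 - x) ^+ m.+2 = x + (1 - x) * (1 - (1 - x) ^+ m.+1).
  by rewrite [in LHS]exprS; ring.
move: IH; rewrite -!(natr1 m.+1) -!(natr1 m).
move: (1 - _ ^+ _) (m%:R) m_ge0 A_gt0 => g k k0 A_gt0 IH.
have step : (x * (1 + k * x / 2) + (1 - x) * (g * (1 + k * x / 2)))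
    <= (x * (1 + k * x / 2) + (1 - x) * ((k + 1) * x)).
  by rewrite lerD2l ler_wpM2l // subr_ge0.
have B_ge0 : 0 <= 1 + (k + 1) * x / 2 by nra.
have := ler_wpM2r B_ge0 step.
(* Exactly the difference that remains once the induction hypothesis is applied. *)
have slack : 0 <= x * (k + 1) * x * (k * x / 4 + x / 2).
  by rewrite !mulr_ge0 // ?addr_ge0 // !mulr_ge0.
by move: slack; lra.
Qed.

(** In reciprocals the recursion gives [1 / theta_{j+1} >= 1 / ((1 + eps) theta_j) + 1 / 4]: linear
    growth, as long as [j <= 1 / eps] keeps the factors [1 + eps] from accumulating. *)
Lemma theta_le (eps : R) j : (2 <= n)%N -> 0 < eps -> n%:R * p = 1 + eps ->
  j%:R * eps <= 1 -> theta j * j.+1%:R <= 8.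
Proof.
move=> n2 eps_gt0 np.
elim: j => [|j IH] jeps; first by rewrite mul1r; lra.
have jeps' : j%:R * eps <= 1 by move: jeps; rewrite -natr1; nra.
have {IH} := IH jeps'.
have /andP[t0 t1] := theta_itv p p_ge0 p_le1 j (n := n).
rewrite [theta j.+1]/=.
move: (theta j) t0 t1 => t t0 t1 IH.
have pt : 0 <= p * t <= 1 by rewrite mulr_ge0 // mulr_ile1.
have := one_sub_expr_le (p * t) n.-1 pt; rewrite prednK; last by lia.
set g := 1 - _ ^+ n.
(* Passing from [n - 1] to [n] weakens the coefficient [1 / 2] to [1 / 4]. *)
have n_half : n%:R <= 2 * n.-1%:R :> R by rewrite -natrM ler_nat; lia.
have -> : n%:R * (p * t) = (1 + eps) * t by rewrite mulrA np.
have g_ge0 : 0 <= g.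
  by case/andP: pt => pt0 pt1; rewrite subr_ge0 exprn_ile1 ?subr_ge0 // gerBl.
have g_le1 : g <= 1.
  by case/andP: pt => pt0 pt1; rewrite gerBl exprn_ge0 // subr_ge0.
have : (1 + eps) * t <= 2 * (n.-1%:R * (p * t)).
  by rewrite -np -mulrA [leRHS]mulrA ler_wpM2r //; case/andP: pt.
move: (n.-1%:R * (p * t)) => z hz gz.
(* theta_{j+1} <= y / (1 + y / 4) for y = (1 + eps) theta_j. *)
have {hz gz} : g * (1 + (1 + eps) * t / 4) <= (1 + eps) * t by nra.
move: g g_ge0 g_le1 => g g_ge0 g_le1 gy.
move: IH jeps; rewrite -!(natr1 j.+1) -!(natr1 j); move: (j%:R) (ler0n R j) => k k0 IH jeps.
(* As [y / (1 + y / 4)] increases with [y], [t] may be replaced by its bound [8 / (k + 1)];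
   weighting [g <= 1] by the defect [8 - t * (k + 1)] does so without division. *)
have D_ge0 : 0 <= (1 + eps) * (8 - t * (k + 1)).
  by rewrite mulr_ge0 ?subr_ge0 // addr_ge0 // ltW.
have gD := ler_wpM2r D_ge0 g_le1.
have k1_ge0 : 0 <= k + 1 by rewrite addr_ge0.
have gyk := ler_wpM2r k1_ge0 gy.
have gk : g * (k + 1 + 2 * (1 + eps)) <= 8 * (1 + eps) by lra.
have e1_gt0 : 0 < 1 + eps by rewrite addr_gt0.
rewrite -(ler_pM2r e1_gt0); apply: le_trans gk.
(* What is left amounts to [k * eps <= 1]. *)
rewrite -mulrA ler_wpM2l //; lra.
Qed.

End ExpectedCost.


(** * Logarithmic bound on the expected charge *)

Lemma harmonic_le_ln {R : realType} m :
  \sum_(j < m.+1) (j.+1%:R)^-1 <= 1 + ln m.+1%:R :> R.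
Proof.
elim: m => [|m IH]; first by rewrite big_ord1 ln1 invr1 addr0.
rewrite big_ord_recr /=; apply: le_trans (lerD IH (lexx _)) _.
rewrite -addrA lerD2l -lerBrDl.
have m1 : 0 < m.+1%:R :> R by [].
have m2 : 0 < m.+2%:R :> R by [].
have inv_lt1 : m.+2%:R^-1 < 1 :> R by rewrite invf_lt1 // ltr1n.
(* This bounds the new term by [ln (m + 2) - ln (m + 1)]. *)
have : ln (1 - m.+2%:R^-1) <= - m.+2%:R^-1 :> R by apply: le_ln1Dx; rewrite ltrN2.
have -> : 1 - m.+2%:R^-1 = m.+1%:R / m.+2%:R :> R.
  apply: (mulIf (lt0r_neq0 m2)); rewrite mulfVK ?lt0r_neq0 // mulrBl.
  by rewrite mulVf ?lt0r_neq0 // -[X in X%:R]addn1 natrD; ring.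
by rewrite ln_div ?posrE // lerNr opprB.
Qed.

Lemma score_bound_le {R : realType} n (p eps : R) h : (2 <= n)%N ->
    0 <= p -> p <= 1 -> 0 < eps -> n%:R * p = 1 + eps -> 1 <= ln (1 / eps) ->
    h%:R * eps <= 1 -> 1 <= h.+1%:R * eps -> eps <= 1 ->
  score_bound (n := n) p h <= 384 * eps * ln (1 / eps).
Proof.
move=> n2 p0 p1 eps0 np L1 heps heps' eps1.
have theta_le8 j : (j <= h)%N -> theta n p j <= 8 / j.+1%:R.
  move=> jh; rewrite ler_pdivlMr //; apply: (theta_le _ p0 p1 _ _ n2 eps0 np).
  by apply: le_trans heps; rewrite ler_wpM2r ?ler_nat // ltW.
have theta_h : theta n p h <= 8 * eps.
  apply: le_trans (theta_le8 h _) _ => //.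
  by rewrite ler_pdivrMr // -mulrA ler_peMr // mulrC.
have t_ge0 j : 0 <= theta n p j by case/andP: (theta_itv p p0 p1 j (n := n)).
rewrite /score_bound.
(* [128 = 2 * 8 * 8], from the orientations of the pair, [theta_le8] and [theta_h]. *)
apply: (@le_trans _ _ (\sum_(j < h.+1) 128 * eps * j.+1%:R^-1)).
  apply: ler_sum => j _.
  have jh : (j <= h)%N by rewrite -ltnS.
  have := ler_pM (t_ge0 j) (t_ge0 h) (theta_le8 j jh) theta_h.
  move=> /(ler_wpM2l (ler0n R 2)) /le_trans; apply.
  by rewrite le_eqVlt; apply/orP; left; apply/eqP; ring.
rewrite -big_distrr /=.
have ln_h : ln h.+1%:R <= 1 + ln (1 / eps) :> R.
  have ieps : 0 < 1 / eps by rewrite divr_gt0.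
  have h_le : h.+1%:R <= 2 * (1 / eps).
    rewrite mulrA mulr1 ler_pdivlMr // -natr1 mulrDl mul1r; lra.
  have : ln h.+1%:R <= ln (2 * (1 / eps)).
    by rewrite ler_ln ?posrE // mulr_gt0.
  rewrite lnM ?posrE // => /le_trans -> //; rewrite lerD2r.
  by have := le_ln1Dx (x := 1 : R); rewrite -natr1 => -> //; lra.
(* The sum is at most [2 + ln (1 / eps)], and [ln (1 / eps) >= 1] absorbs the 2. *)
have sum_le : \sum_(j < h.+1) (j.+1%:R)^-1 <= 3 * ln (1 / eps).
  by have := harmonic_le_ln (R := R) h; lra.
have -> : 384 * eps * ln (1 / eps) = 128 * eps * (3 * ln (1 / eps)) by ring.
by rewrite ler_wpM2l // mulr_ge0 // ltW.
Qed.

(** * Probability of revealing a long path *)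

Section DeterministicStrategy.
Context {R : realType} {n : nat}.
Variables (p : R) (h l : nat).
Hypotheses (p_ge0 : 0 <= p) (p_le1 : p <= 1) (h_gt0 : (0 < h)%N) (hl : (6 * h <= l)%N).

(** The path has [l + 1] vertices, and the slack [3 * h] is at most [l / 2]. *)
Lemma has_path_le_cost (t : strategy n) (G : graph n) :
  has_path (revealed t G) l -> (l <= 6 * cost h t set0 G)%N.
Proof.
case=> s [us ss ps].
have sG : revealed t G \subset G by apply: subsetIr.
have := path_le_score h (prior t set0 G) G _ _ s h_gt0 sG _ (subxx _) us ps.
rewrite ss -sum_prior_cost setD0 => bound.
have : (l.+1 <= 3 * \sum_(e in revealed t G)
                     score h e (G :\: (e |: prior t set0 G e)) + 3 * h)%N.
  apply: bound => A A0 sA; apply: prior_min => //.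
  by rewrite setD0; apply: subset_trans sA _; apply: subsetIl.
by rewrite /revealed; lia.
Qed.

Lemma gnp_has_path_le (t : strategy n) (b : R) :
  (forall G, #|queried t G|%:R <= b) ->
  \sum_G gnp p G * (`[< has_path (revealed t G) l >])%:R * l%:R
    <= 6 * p * score_bound (n := n) p h * b.
Proof.
move=> qb.
have -> : \sum_G gnp p G * (`[< has_path (revealed t G) l >])%:R * l%:R =
    Ex p (enum (vpair n)) (fun G => (`[< has_path (revealed t G) l >])%:R * l%:R).
  rewrite Ex_sum ?enum_uniq //; apply: eq_big => [G|G _].
    by symmetry; apply/subsetP => x _; rewrite mem_enum.
  by rewrite -mulrA /gnp big_enum.
have B_ge0 : 0 <= score_bound (n := n) p h.
  apply: sumr_ge0 => j _; rewrite !mulr_ge0 //.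
    by case/andP: (theta_itv p p_ge0 p_le1 j (n := n)).
  by case/andP: (theta_itv p p_ge0 p_le1 h (n := n)).
apply: (@le_trans _ _ (6 * Ex p (enum (vpair n)) (fun G => 1 * (cost h t set0 G)%:R))).
  rewrite -ExZ; apply: ler_Ex => // G; rewrite mul1r -natrM -natrM ler_nat.
  by case: asboolP => [/has_path_le_cost|_]; rewrite ?mul1n.
rewrite -!mulrA ler_pM2l // mulrA.
apply: le_trans (Ex_cost_le p h p_ge0 p_le1 t set0 (fun=> 1) _ _) _ => //.
rewrite ler_wpM2l ?mulr_ge0 // -[leRHS](Ex_cst p (enum (vpair n))).
by apply: ler_Ex => // G; rewrite mul1r setD0.
Qed.

End DeterministicStrategy.

(** Exchanging the sum over graphs with the integral over seeds passes a bound valid for each fixed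
    strategy to the mixture. *)
Lemma reveal_prob_le {R : realType} n (A : algorithm R n) (p : R) l (c : R) :
  0 <= p -> p <= 1 ->
  (forall w : seed A, \sum_G gnp p G * (`[< has_path (revealed (run w) G) l >])%:R <= c) ->
  (reveal_prob A p l <= c%:E)%E.
Proof.
move=> p0 p1 Hc; rewrite /reveal_prob.
pose S G := [set w : seed A | has_path (revealed (run w) G) l]%classic.
have gnp_ge0 (G : graph n) : 0 <= gnp p G.
  by apply: prodr_ge0 => e _; case: ifP; rewrite ?subr_ge0.
have mS G : measurable (S G).
  exact: (@run_measurable _ _ A [set t | has_path (revealed t G) l]%classic).
have mI G : measurable_fun [set: seed A]%classic (fun w => (\1_(S G) w)%:E : \bar R).
  by apply/measurable_EFinP; apply: measurable_indic.
have mgI G : measurable_fun [set: seed A]%classic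
    (fun w => ((gnp p G)%:E * (\1_(S G) w)%:E)%E).
  exact: measurable_funeM.
have gI_ge0 G w : (0 <= (gnp p G)%:E * (\1_(S G) w)%:E)%E.
  by rewrite -EFinM lee_fin mulr_ge0.
have -> : (\sum_(G : graph n) (gnp p G)%:E * seed_law A (S G) =
   \int[seed_law A]_w \sum_(G : graph n) ((gnp p G)%:E * (\1_(S G) w)%:E))%E.
  rewrite ge0_integral_sum //; apply: eq_bigr => G _.
  by rewrite ge0_integralZl_EFin // integral_indic // classical_sets.setIT.
apply: (@le_trans _ _ (\int[seed_law A]_w cst c%:E w)%E).
  apply: ge0_le_integral => //.
  - by move=> w _; apply: sume_ge0.
  - exact: emeasurable_sum.
  move=> w _; under eq_bigr do rewrite -EFinM.
  rewrite sumEFin lee_fin; apply: le_trans (Hc w).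
  by apply: ler_sum => G _; rewrite indicE; exact: lexx.
have mass1 := probability_setT (seed_law A).
by rewrite integral_cst // -[leRHS]mule1 -mass1.
Qed.

Lemma reveal_prob_bound {R : realType} n (p eps b : R) l (A : algorithm R n) :
    (2 <= n)%N -> n%:R * p = 1 + eps -> 0 < eps -> eps < expR (-1) ->
    6 / eps * ln (1 / eps) <= l%:R ->
    queries_at_most A b ->
  (reveal_prob A p l <= (2304 * (p * eps * ln (1 / eps)) * b / l%:R)%:E)%E.
Proof.
move=> n2 np eps_gt0 eps_lt l_large A_queries.
have eps_lt1 : eps < 1 by apply: lt_trans eps_lt _; rewrite expR_lt1; lra.
have L_ge1 : 1 <= ln (1 / eps).
  rewrite div1r lnV ?posrE // lerNr -[leRHS]expRK ler_ln ?posrE ?expR_gt0 //.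
  exact: ltW.
have n_gt0 : 0 < n%:R :> R by rewrite ltr0n; lia.
have p_gt0 : 0 < p by rewrite -(pmulr_rgt0 _ n_gt0) np addr_gt0.
have p_le1 : p <= 1.
  rewrite -(ler_pM2l n_gt0) np mulr1; apply: (@le_trans _ _ 2); first by lra.
  by rewrite ler_nat.
(* Rounding down gives both [h * eps <= 1] and [1 <= h.+1 * eps]. *)
pose h := Num.trunc (1 / eps).
have ieps_ge1 : 1 <= 1 / eps by rewrite ler_pdivlMr // mul1r ltW.
have /andP[h_le h_gt] : h%:R <= 1 / eps < h.+1%:R.
  by apply: trunc_itv; apply: le_trans ieps_ge1.
have h_gt0 : (0 < h)%N.
  by have := le_lt_trans ieps_ge1 h_gt; rewrite ltr1n ltnS.
have hl : (6 * h <= l)%N.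
  rewrite -(ler_nat R) natrM; apply: le_trans l_large.
  apply: (@le_trans _ _ (6 * (1 / eps))); first by rewrite ler_pM2l.
  by rewrite mulrA mulr1 ler_peMr // ltW // divr_gt0.
have l_gt0 : 0 < l%:R :> R by rewrite ltr0n; lia.
have B_le : score_bound (n := n) p h <= 384 * eps * ln (1 / eps).
  apply: score_bound_le => //; rewrite ?(ltW p_gt0) ?(ltW eps_lt1) //.
    by rewrite -ler_pdivlMr.
  by rewrite -ler_pdivrMr // ltW.
apply: reveal_prob_le => // [|w]; first exact: ltW.
have b_ge0 : 0 <= b by apply: le_trans (A_queries w set0).
rewrite ler_pdivlMr // big_distrl /=.
apply: le_trans (gnp_has_path_le p h l (ltW p_gt0) p_le1 h_gt0 hl
  (run w) b (A_queries w)) _.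
rewrite ler_wpM2r //.
have -> : 2304 * (p * eps * ln (1 / eps)) = 6 * p * (384 * eps * ln (1 / eps)) by ring.
by rewrite ler_pM2l // mulr_gt0.
Qed.

Theorem theorem1 (R : realType) :
  exists C : R, 0 < C /\
  forall q : R, 0 < q -> q < 1 ->
  exists (n0 : nat) (eps0 : R), (0 < n0)%N /\ 0 < eps0 /\
  forall eps : R, 0 < eps -> eps < eps0 ->
  forall n : nat, (n0 <= n)%N ->
  let p : R := (1 + eps) / n%:R in
  forall l : nat, 3 * C / eps * ln (1 / eps) <= l%:R ->
  ~ exists A : algorithm R n,
      queries_at_most A (q * l%:R / (8640 * C * p * eps * ln (1 / eps))) /\
      (q%:E <= reveal_prob A p l)%E.
Proof.
(* No constant depends on [q]: [C = 2] gives the threshold [6 / eps], [n >= 2] gives [p <= 1], and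
   [eps < expR (-1)] gives [ln (1 / eps) >= 1]. *)
exists 2; split=> // q q_gt0 q_lt1; exists 2%N, (expR (-1)); split=> //.
split=> [|eps eps_gt0 eps_lt n n2 p l]; first exact: expR_gt0.
have n_gt0 : 0 < n%:R :> R by rewrite ltr0n; lia.
have np : n%:R * p = 1 + eps by rewrite mulrC mulfVK ?gt_eqF.
have -> : 3 * 2 / eps = 6 / eps by rewrite -natrM.
move=> l_large [A [A_queries A_reveals]].
have := le_trans A_reveals
  (reveal_prob_bound _ _ _ _ _ _ n2 np eps_gt0 eps_lt l_large A_queries).
rewrite lee_fin {A_queries A_reveals}; move: p np => p np.
have L_gt0 : 0 < ln (1 / eps).
  rewrite ln_gt0 // ltr_pdivlMr // mul1r; apply: lt_trans eps_lt _.
  by rewrite expR_lt1; lra.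
have l_gt0 : 0 < l%:R :> R.
  by apply: lt_le_trans l_large; rewrite mulr_gt0 // divr_gt0.
have p_gt0 : 0 < p by rewrite -(pmulr_rgt0 _ n_gt0) np addr_gt0.
have : 2304 < 8640 :> R by rewrite ltr_nat.
(* Only [M < N] matters: the probability is at most [M / N * (q / 2)], below [q]. *)
move: (2304 : R) (8640 : R) (ler0n R 2304) => M N M_ge0 MN.
have N_gt0 : 0 < N by apply: le_lt_trans MN.
have -> : M * (p * eps * ln (1 / eps)) *
    (q * l%:R / (N * 2 * p * eps * ln (1 / eps))) / l%:R = M / N * (q / 2).
  by field; rewrite !gt_eqF.
suff : M / N * (q / 2) < q by move=> /lt_le_trans h /h; rewrite ltxx.
have MN_lt1 : M / N < 1 by rewrite ltr_pdivrMr // mul1r.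
by nra.
Qed.
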